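(* Equip the group $\boldsymbol{ax+b}$ with the discrete topology and let $H_{\boldsymbol b}=\{(1,b):b\in\mathbb{R}\}$. Let $\omega$ be a weight on $\boldsymbol{ax+b}$ that is bounded away from zero and is bounded on $H_{\boldsymbol b}$. Then $\ell^1(\boldsymbol{ax+b},\omega)$ is weakly amenable if and only if $\omega$ is diagonally bounded on $\boldsymbol{ax+b}$.
   Context: The group $\boldsymbol{ax+b}=\{(a,b):a\in\mathbb{R},\,a>0,\,b\in\mathbb{R}\}$ has product $(a,b)(c,d)=(ac,ad+b)$. A weight on a discrete group $G$ is a function $\omega:G\to(0,\infty)$ with $\omega(xy)\le\omega(x)\omega(y)$ for all $x,y\in G$; it is diagonally bounded if $\sup_{x\in G}\omega(x)\omega(x^{-1})<\infty$. $\ell^1(G,\omega)=\{f:G\to\mathbb{C}:\|f\|_\omega=\sum_{x\in G}|f(x)|\omega(x)<\infty\}$ with convolution product is a Banach algebra. A Banach algebra $A$ is weakly amenable if every continuous derivation $D:A\to A^*$ (linear, $D(ab)=a\cdot D(b)+D(a)\cdot b$) is inner, i.e. of the form $a\mapsto a\cdot f-f\cdot a$ for some $f\in A^*$; here $A^*$ has the module actions $\langle x,a\cdot f\rangle=\langle xa,f\rangle$, $\langle x,f\cdot a\rangle=\langle ax,f\rangle$. *)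

(* Defs.v *)
From HB Require Import structures.
From mathcomp Require Import all_boot all_order all_algebra.
From mathcomp Require Import complex finmap.
From mathcomp Require Import all_classical all_reals all_analysis.
From mathcomp Require Import ring lra.

Set Implicit Arguments.
Unset Strict Implicit.
Unset Printing Implicit Defensive.
Import Order.TTheory GRing.Theory Num.Theory.
Import numFieldNormedType.Exports.
Import ComplexField.Normc.
Local Open Scope classical_set_scope.
Local Open Scope ring_scope.
Local Open Scope complex_scope.
Local Notation Re := (@complex.Re _).
Local Notation Im := (@complex.Im _).

Section complex_sum.
Context (R : realType) (T : choiceType).
Implicit Types (f g : T -> R[i]) (a b : T -> R).

(* Unordered sums. \esum is only meaningful for nonnegative terms, so the sum of
   a real family is the difference of the sums of its positive and negative
   parts, and a complex family is summed through its real and imaginary parts.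
   Both agree with the usual value when the family is absolutely summable, and
   are only used in that case. *)
Definition rsum a : R :=
  fine (\esum_(x in [set: T]) (EFin \o a)^\+ x
        - \esum_(x in [set: T]) (EFin \o a)^\- x)%E.

Definition csum f : R[i] := rsum (Re \o f) +i* rsum (Im \o f).

Definition abs_summable f := (\esum_(x in [set: T]) (normc (f x))%:E < +oo)%E.

Local Notation E a := (\esum_(x in [set: T]) (a x)%:E)%E.

Lemma esumr_ge0 a : (forall x, 0 <= a x) -> (0 <= E a)%E.
Proof. by move=> a0; apply: esum_ge0 => x _; rewrite lee_fin. Qed.

Lemma esumr_fin a : (forall x, 0 <= a x) -> (E a < +oo)%E -> (E a \is a fin_num).
Proof. by move=> a0 aoo; rewrite ge0_fin_numE// esumr_ge0. Qed.

Lemma le_esumr_lty a b : (forall x, a x <= b x) -> (E b < +oo)%E -> (E a < +oo)%E.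
Proof.
move=> ab; apply: le_lt_trans; apply: le_esum => x _; by rewrite lee_fin.
Qed.

Lemma esumrZ (c : R) a : 0 <= c -> (forall x, 0 <= a x) ->
  E (fun x => c * a x) = (c%:E * E a)%E.
Proof.
move=> c0 a0; rewrite /esum -ereal_supZl//; last first.
  by apply/set0P; exists 0%E; exists set0; [exact: fsets_set0|rewrite fsbig_set0].
congr ereal_sup; rewrite image_comp; apply: eq_imagel => A [finA _] /=.
by rewrite ge0_mule_fsumr// => x; rewrite lee_fin.
Qed.

Lemma rsumB a b : (forall x, 0 <= a x) -> (forall x, 0 <= b x) ->
  (E a < +oo)%E -> (E b < +oo)%E ->
  rsum (fun x => a x - b x) = fine (E a) - fine (E b).
Proof.
move=> a0 b0 aoo boo; rewrite -fineB ?esumr_fin//; congr fine.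
have -> : EFin \o (fun x => a x - b x) = ((EFin \o a) \- (EFin \o b))%E by [].
rewrite (esumB (D := [set: T]))//; rewrite /summable.
- by rewrite (eq_esum (b := EFin \o a))// => x _ /=; rewrite ger0_norm.
- by rewrite (eq_esum (b := EFin \o b))// => x _ /=; rewrite ger0_norm.
- by move=> x _; rewrite /= lee_fin.
- by move=> x _; rewrite /= lee_fin.
Qed.

Lemma normc_Re (z : R[i]) : `|Re z| <= normc z.
Proof.
by case: z => x y /=; rewrite -sqrtr_sqr ler_wsqrtr// lerDl sqr_ge0.
Qed.

Lemma normc_Im (z : R[i]) : `|Im z| <= normc z.
Proof.
by case: z => x y /=; rewrite -sqrtr_sqr ler_wsqrtr// lerDr sqr_ge0.
Qed.

Lemma normc_ge0 (z : R[i]) : 0 <= normc z.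
Proof. by case: z => x y /=; exact: sqrtr_ge0. Qed.

Lemma normcE (z : R[i]) : `|z| = (normc z)%:C.
Proof. by []. Qed.

Lemma normcD (y z : R[i]) : normc (y + z) <= normc y + normc z.
Proof. by rewrite -lecR rmorphD/= -!normcE ler_normD. Qed.

Let pos (t : R) := Num.max t 0.
Let neg (t : R) := Num.max (- t) 0.
Let posneg t : t = pos t - neg t.
Proof. by rewrite /pos /neg; case: (leP t 0) => ?; case: leP => ?; lra. Qed.
Let pos_ge0 t : 0 <= pos t. Proof. by rewrite /pos le_max lexx orbT. Qed.
Let neg_ge0 t : 0 <= neg t. Proof. by rewrite /neg le_max lexx orbT. Qed.
Let pos_le t : pos t <= `|t|.
Proof. by rewrite /pos ge_max ler_norm normr_ge0. Qed.
Let neg_le t : neg t <= `|t|.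
Proof. by rewrite /neg ge_max -normrN ler_norm normr_ge0. Qed.

Local Notation rs a := (E (fun x => `|a x|) < +oo)%E.

Lemma rsumE a : rs a ->
  rsum a = fine (E (fun x => pos (a x))) - fine (E (fun x => neg (a x))).
Proof.
move=> aoo; rewrite -rsumB//.
- by congr rsum; apply/funext => x; exact: posneg.
- by apply: le_esumr_lty aoo.
- by apply: le_esumr_lty aoo.
Qed.

Lemma esumrD a b : (forall x, 0 <= a x) -> (forall x, 0 <= b x) ->
  E (fun x => a x + b x) = (E a + E b)%E.
Proof.
move=> a0 b0; rewrite -esumD//; last by move=> x _; rewrite lee_fin.
by move=> x _; rewrite lee_fin.
Qed.

Lemma rsD a b : rs a -> rs b -> rs (fun x => a x + b x).
Proof.
move=> ha hb; apply: (@le_esumr_lty _ (fun x => `|a x| + `|b x|)).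
  by move=> x; exact: ler_normD.
by rewrite esumrD// lte_add_pinfty.
Qed.

Lemma rsZ c a : rs a -> rs (fun x => c * a x).
Proof.
move=> ha; under eq_esum do rewrite normrM.
by rewrite esumrZ// lte_mul_pinfty.
Qed.

Lemma rsumD a b : rs a -> rs b ->
  rsum (fun x => a x + b x) = rsum a + rsum b.
Proof.
move=> ha hb.
have [pa na] : (E (fun x => pos (a x)) < +oo)%E /\ (E (fun x => neg (a x)) < +oo)%E.
  by split; apply: le_esumr_lty ha.
have [pb nb] : (E (fun x => pos (b x)) < +oo)%E /\ (E (fun x => neg (b x)) < +oo)%E.
  by split; apply: le_esumr_lty hb.
rewrite (rsumE ha) (rsumE hb).
transitivity (rsum (fun x => (pos (a x) + pos (b x)) - (neg (a x) + neg (b x)))).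
  by congr rsum; apply/funext => x; rewrite [in LHS](posneg (a x)) [in LHS](posneg (b x)); lra.
rewrite rsumB.
- rewrite !esumrD// !fineD ?esumr_fin//; lra.
- by move=> x; rewrite addr_ge0.
- by move=> x; rewrite addr_ge0.
- by rewrite esumrD// lte_add_pinfty.
- by rewrite esumrD// lte_add_pinfty.
Qed.

Lemma rsumN a : rs a -> rsum (fun x => - a x) = - rsum a.
Proof.
move=> ha; rewrite (rsumE ha) opprB -rsumB//.
- by congr rsum; apply/funext => x; rewrite [in LHS](posneg (a x)); lra.
- by apply: le_esumr_lty ha.
- by apply: le_esumr_lty ha.
Qed.

Lemma rsumZ c a : rs a -> rsum (fun x => c * a x) = c * rsum a.
Proof.
move=> ha.
wlog c0 : c / 0 <= c => [hw|].
  have [/hw//|c0] := leP 0 c.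
  have := hw (- c); rewrite oppr_ge0 (ltW c0) => /(_ isT).
  under [X in rsum X]eq_fun do rewrite mulNr.
  by rewrite rsumN ?mulNr; [move/oppr_inj|exact: rsZ].
have [pa na] : (E (fun x => pos (a x)) < +oo)%E /\ (E (fun x => neg (a x)) < +oo)%E.
  by split; apply: le_esumr_lty ha.
rewrite (rsumE ha).
transitivity (rsum (fun x => (c * pos (a x)) - (c * neg (a x)))).
  by congr rsum; apply/funext => x; rewrite [in LHS](posneg (a x)); ring.
rewrite rsumB.
- by rewrite !esumrZ// !fineM ?esumr_fin//= mulrBr.
- by move=> x; rewrite mulr_ge0.
- by move=> x; rewrite mulr_ge0.
- by rewrite esumrZ// lte_mul_pinfty ?lee_fin// esumr_fin.
- by rewrite esumrZ// lte_mul_pinfty ?lee_fin// esumr_fin.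
Qed.

Lemma rsum_norm a : rs a -> (`|rsum a|%:E <= E (fun x => `|a x|))%E.
Proof.
move=> ha.
have [pa na] : (E (fun x => pos (a x)) < +oo)%E /\ (E (fun x => neg (a x)) < +oo)%E.
  by split; apply: le_esumr_lty ha.
rewrite -[leRHS]fineK ?esumr_fin// lee_fin (rsumE ha).
have p0 : 0 <= fine (E (fun x => pos (a x))) by rewrite fine_ge0// esumr_ge0.
have n0 : 0 <= fine (E (fun x => neg (a x))) by rewrite fine_ge0// esumr_ge0.
have ple : fine (E (fun x => pos (a x))) <= fine (E (fun x => `|a x|)).
  by rewrite fine_le ?esumr_fin//; apply: le_esum => x _; rewrite lee_fin.
have nle : fine (E (fun x => neg (a x))) <= fine (E (fun x => `|a x|)).
  by rewrite fine_le ?esumr_fin//; apply: le_esum => x _; rewrite lee_fin.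
by rewrite ler_norml; apply/andP; split; lra.
Qed.

Lemma le_esumr_term a x0 : (forall x, 0 <= a x) -> ((a x0)%:E <= E a)%E.
Proof.
move=> a0; apply: esum_ge; exists [set x0]; last by rewrite fsbig_set1.
by split => //; exact: finite_set1.
Qed.

Lemma abs_summableRe f : abs_summable f -> rs (Re \o f).
Proof. by apply: le_esumr_lty => x; exact: normc_Re. Qed.

Lemma abs_summableIm f : abs_summable f -> rs (Im \o f).
Proof. by apply: le_esumr_lty => x; exact: normc_Im. Qed.

Lemma abs_summableD f g : abs_summable f -> abs_summable g ->
  abs_summable (fun x => f x + g x).
Proof.
move=> hf hg; apply: (@le_esumr_lty _ (fun x => normc (f x) + normc (g x))).
  by move=> x; exact: normcD.
by rewrite esumrD ?lte_add_pinfty// => x; exact: normc_ge0.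
Qed.

Lemma abs_summableZ c f : abs_summable f -> abs_summable (fun x => c * f x).
Proof.
move=> hf; rewrite /abs_summable; under eq_esum do rewrite normcM.
rewrite esumrZ; [|exact: normc_ge0|by move=> x; exact: normc_ge0].
by rewrite lte_mul_pinfty// lee_fin normc_ge0.
Qed.

Lemma csumD f g : abs_summable f -> abs_summable g ->
  csum (fun x => f x + g x) = csum f + csum g.
Proof.
move=> hf hg.
rewrite /csum; apply/eqP; rewrite eq_complex /=; apply/andP; split; apply/eqP.
- rewrite -rsumD; [|exact: abs_summableRe|exact: abs_summableRe].
  by congr rsum; apply/funext => x /=; rewrite raddfD.
- rewrite -rsumD; [|exact: abs_summableIm|exact: abs_summableIm].
  by congr rsum; apply/funext => x /=; rewrite raddfD.
Qed.

Lemma csumZ c f : abs_summable f -> csum (fun x => c * f x) = c * csum f.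
Proof.
move=> hf; have hr := abs_summableRe hf; have hi := abs_summableIm hf.
case: c => u v.
have -> : (u +i* v) * csum f = (u * rsum (Re \o f) - v * rsum (Im \o f)) +i*
    (u * rsum (Im \o f) + v * rsum (Re \o f)) by [].
rewrite /csum; congr (_ +i* _).
  transitivity (rsum (fun x => u * (Re \o f) x + - (v * (Im \o f) x))).
    by congr rsum; apply/funext => x /=; case: (f x).
  rewrite rsumD; [|exact: rsZ|].
    by rewrite (rsumN (rsZ v hi)) (rsumZ u hr) (rsumZ v hi).
  by under eq_esum do rewrite normrN; exact: rsZ.
transitivity (rsum (fun x => u * (Im \o f) x + v * (Re \o f) x)).
  by congr rsum; apply/funext => x /=; case: (f x).
by rewrite rsumD ?(rsumZ u hi) ?(rsumZ v hr)//; exact: rsZ.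
Qed.

Lemma csum_norm f : abs_summable f ->
  ((normc (csum f))%:E <= \esum_(x in [set: T]) (normc (f x))%:E)%E.
Proof.
move=> hf; have [->|s0] := eqVneq (csum f) 0.
  by rewrite normc0 esumr_ge0// => x; exact: normc_ge0.
set s := csum f; set u := (normc s)%:C / s.
have us : (normc s)%:C = u * s by rewrite /u divfK.
have nu : normc u = 1.
  rewrite /u normcM normcV.
  have -> : normc (normc s)%:C = normc s.
    by rewrite /= expr0n /= addr0 sqrtr_sqr ger0_norm// normc_ge0.
  by rewrite divff//; apply: contra s0 => /eqP/eq0_normc/eqP.
have -> : normc s = rsum (Re \o (fun x => u * f x)).
  by move: us; rewrite -csumZ// => /(congr1 Re).
have huf : abs_summable (fun x => u * f x) by exact: abs_summableZ.
apply: (@le_trans _ _ `|rsum (Re \o (fun x => u * f x))|%:E).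
  by rewrite lee_fin ler_norm.
apply: le_trans (rsum_norm (abs_summableRe huf)) _.
apply: le_esum => x _; rewrite lee_fin (le_trans (normc_Re _))//=.
by rewrite normcM nu mul1r.
Qed.

End complex_sum.

Section reindex.
Context (R : realType) (T1 T2 : choiceType).

Lemma csum_reindex (e : T1 -> T2) (f : T2 -> R[i]) :
  set_bij [set: T1] [set: T2] e -> csum (f \o e) = csum f.
Proof.
move=> be; rewrite /csum.
have rs (a : T2 -> R) : rsum (a \o e) = rsum a.
  by congr (fine (_ - _)%E); rewrite [RHS](reindex_esum _ _ _ _ be);
    apply: eq_esum => x _; rewrite ?funeposE ?funenegE.
by rewrite -(rs (Re \o f)) -(rs (Im \o f)).
Qed.

Local Notation E a := (\esum_(x in setT) (a x)%:E)%E.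

Lemma esumr_pair (a : T1 -> T2 -> R) : (forall x y, 0 <= a x y) ->
  (\esum_(x in [set: T1]) \esum_(y in [set: T2]) (a x y)%:E =
   \esum_(k in [set: T1 * T2]) (a k.1 k.2)%:E)%E.
Proof.
move=> a0; rewrite esum_esum; last by move=> x y _ _; rewrite lee_fin.
by congr esum; apply/seteqP; split.
Qed.

Lemma esumr_row (a : T1 * T2 -> R) x : (forall k, 0 <= a k) ->
  (E a < +oo)%E -> (\esum_(y in [set: T2]) (a (x, y))%:E < +oo)%E.
Proof.
move=> a0; apply: le_lt_trans.
rewrite (_ : E a = \esum_(x in [set: T1]) \esum_(y in [set: T2]) (a (x, y))%:E)%E; last first.
  by rewrite (esumr_pair (a := fun x y => a (x, y)))//; apply: eq_esum => -[].
apply: esum_ge; exists [set x]; last by rewrite fsbig_set1.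
by split => //; exact: finite_set1.
Qed.

Lemma rsum_fubini (a : T1 * T2 -> R) : (E (fun k => `|a k|) < +oo)%E ->
  rsum (fun x => rsum (fun y => a (x, y))) = rsum a.
Proof.
move=> ha; rewrite (rsumE ha).
set p := fun k => Num.max (a k) 0; set n := fun k => Num.max (- a k) 0.
have p0 k : 0 <= p k by rewrite /p le_max lexx orbT.
have n0 k : 0 <= n k by rewrite /n le_max lexx orbT.
have pa k : p k <= `|a k| by rewrite /p ge_max ler_norm normr_ge0.
have na k : n k <= `|a k| by rewrite /n ge_max -normrN ler_norm normr_ge0.
have hp : (E p < +oo)%E by apply: le_esumr_lty ha.
have hn : (E n < +oo)%E by apply: le_esumr_lty ha.
have rp x : (\esum_(y in [set: T2]) (p (x, y))%:E \is a fin_num)%E.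
  by apply: esumr_fin => //; apply: esumr_row.
have rn x : (\esum_(y in [set: T2]) (n (x, y))%:E \is a fin_num)%E.
  by apply: esumr_fin => //; apply: esumr_row.
under [X in rsum X]eq_fun => x.
  rewrite rsumE; last by apply: (esumr_row (a := fun k => `|a k|)).
  over.
have Ep : (\esum_(x in [set: T1]) (fine (\esum_(y in [set: T2]) (p (x, y))%:E))%:E = E p)%E.
  under eq_esum do rewrite fineK//.
  by rewrite (esumr_pair (a := fun x y => p (x, y)))//; apply: eq_esum => -[].
have En : (\esum_(x in [set: T1]) (fine (\esum_(y in [set: T2]) (n (x, y))%:E))%:E = E n)%E.
  under eq_esum do rewrite fineK//.
  by rewrite (esumr_pair (a := fun x y => n (x, y)))//; apply: eq_esum => -[].
rewrite rsumB.
- by rewrite Ep En.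
- by move=> x; rewrite fine_ge0// esumr_ge0// => y; exact: p0.
- by move=> x; rewrite fine_ge0// esumr_ge0// => y; exact: n0.
- by rewrite Ep.
- by rewrite En.
Qed.

Lemma csum_fubini (f : T1 * T2 -> R[i]) : abs_summable f ->
  csum (fun x => csum (fun y => f (x, y))) = csum f.
Proof.
move=> hf; rewrite [RHS]/csum.
rewrite -(rsum_fubini (abs_summableRe hf)) -(rsum_fubini (abs_summableIm hf)).
by rewrite [LHS]/csum.
Qed.

End reindex.

Lemma csum_exchange (R : realType) (T1 T2 : choiceType) (f : T1 -> T2 -> R[i]) :
  (\esum_(x in [set: T1]) \esum_(y in [set: T2]) (normc (f x y))%:E < +oo)%E ->
  csum (fun x => csum (f x)) = csum (fun y => csum (f^~ y)).
Proof.
rewrite esumr_pair; last by move=> *; exact: normc_ge0.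
move=> hf; rewrite (@csum_fubini _ _ _ (fun k => f k.1 k.2))//.
have bs : set_bij [set: T2 * T1] [set: T1 * T2] (fun k => (k.2, k.1)).
  by split=> //= [[a b] [c d] _ _ [-> ->]//|[a b] _]; exists (b, a).
rewrite -(csum_reindex _ bs) -csum_fubini//.
by move: hf; rewrite /abs_summable (reindex_esum _ _ _ _ bs).
Qed.

Record weight (R : realType) (G : groupType) := Weight {
  weight_fun :> G -> R;
  weight_gt0 : forall x, 0 < weight_fun x;
  weightM : forall x y, weight_fun (x * y)%g <= weight_fun x * weight_fun y
}.

Lemma mule_ltyl (R : realType) (c : R) (S : \bar R) :
  0 < c -> (c%:E * S < +oo)%E -> (S < +oo)%E.
Proof. by case: S => [r||]//= c0; rewrite ?ltry// gt0_muley ?lte_fin. Qed.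

Section nonneg_convolution.
Context (R : realType) (G : groupType).
Implicit Types F H : G -> R.
Local Notation E a := (\esum_(x in [set: G]) (a x)%:E)%E.

Lemma mulg_bij (g : G) : set_bij [set: G] [set: G] (fun x => (g * x)%g).
Proof.
split=> //= [x y _ _ /mulgI//|y _].
by exists (g^-1 * y)%g => //; rewrite mulgA mulgV mul1g.
Qed.

Lemma esumr_translate F (g : G) : E (fun x => F (g * x)%g) = E F.
Proof. by rewrite [RHS](reindex_esum _ _ _ _ (mulg_bij g)). Qed.

(* convolution of nonnegative functions, only used to bound convolution *)
Definition nnconv F H x : \bar R :=
  (\esum_(y in [set: G]) (F y * H (y^-1 * x)%g)%:E)%E.

Lemma esum_nnconv F H : (forall x, 0 <= F x) -> (forall x, 0 <= H x) ->
  (E F < +oo)%E -> (E H < +oo)%E ->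
  (\esum_(x in [set: G]) nnconv F H x = E F * E H)%E.
Proof.
move=> F0 H0 Foo Hoo.
have A0 x y : 0 <= F y * H (y^-1 * x)%g by rewrite mulr_ge0.
rewrite /nnconv (esumr_pair A0) -[in RHS](fineK (esumr_fin H0 Hoo)) muleC.
have bs : set_bij [set: G * G] [set: G * G] (fun k => (k.2, k.1)).
  by split=> //= [[a b] [c d] _ _ [-> ->]//|[a b] _]; exists (b, a).
rewrite (reindex_esum _ _ _ _ bs)/=.
rewrite -(esumr_pair (a := fun y x => F y * H (y^-1 * x)%g))//.
rewrite -esumrZ ?fine_ge0 ?esumr_ge0//; apply: eq_esum => y _.
by rewrite esumrZ// (esumr_translate H) -[X in (_ * X)%E](fineK (esumr_fin H0 Hoo)) -EFinM mulrC.
Qed.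

Lemma esum_nnconv_lty F H : (forall x, 0 <= F x) -> (forall x, 0 <= H x) ->
  (E F < +oo)%E -> (E H < +oo)%E -> (\esum_(x in [set: G]) nnconv F H x < +oo)%E.
Proof.
move=> F0 H0 Foo Hoo.
rewrite esum_nnconv// -(fineK (esumr_fin F0 Foo)) -(fineK (esumr_fin H0 Hoo)) -EFinM.
exact: ltry.
Qed.

Lemma nnconv_lty F H : (forall x, 0 <= F x) -> (forall x, 0 <= H x) ->
  (E F < +oo)%E -> (E H < +oo)%E -> forall x, (nnconv F H x < +oo)%E.
Proof.
move=> F0 H0 Foo Hoo x; have := esum_nnconv_lty F0 H0 Foo Hoo.
apply: le_lt_trans; apply: esum_ge; exists [set x]; last by rewrite fsbig_set1.
by split => //; exact: finite_set1.
Qed.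

Lemma nnconv_ge0 F H x : (forall x, 0 <= F x) -> (forall x, 0 <= H x) ->
  (0 <= nnconv F H x)%E.
Proof. by move=> F0 H0; apply: esumr_ge0 => y; rewrite mulr_ge0. Qed.

End nonneg_convolution.

Section beurling.
Context (R : realType) (G : groupType) (w : weight R G).
Implicit Types f g h : G -> R[i].

(* the norm of l^1(G, w), possibly +oo *)
Definition wnorm f : \bar R := (\esum_(x in [set: G]) (normc (f x) * w x)%:E)%E.

Definition convolution f g (x : G) : R[i] :=
  csum (fun y => f y * g (y^-1 * x)%g).

Let wn f x := normc (f x) * w x.
Let w0 x : 0 <= w x. Proof. exact/ltW/weight_gt0. Qed.
Let wn0 f x : 0 <= wn f x. Proof. by rewrite mulr_ge0// normc_ge0. Qed.

Lemma wnorm_ge0 f : (0 <= wnorm f)%E.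
Proof. by apply: esumr_ge0 => x; exact: wn0. Qed.

Lemma wnorm_fin f : (wnorm f < +oo)%E -> wnorm f \is a fin_num.
Proof. by move=> foo; rewrite ge0_fin_numE// wnorm_ge0. Qed.

Lemma wnormD f g : (wnorm (f \+ g)%R <= wnorm f + wnorm g)%E.
Proof.
rewrite /wnorm -esumrD; [|exact: wn0|exact: wn0].
by apply: le_esum => x _; rewrite lee_fin -mulrDl ler_wpM2r// normcD.
Qed.

Lemma wnormZ (c : R[i]) f : (wnorm (fun x => c * f x)%R = (normc c)%:E * wnorm f)%E.
Proof.
rewrite /wnorm -esumrZ; [|exact: normc_ge0|exact: wn0].
by apply: eq_esum => x _; rewrite normcM mulrA.
Qed.

Lemma wnorm0 : wnorm 0 = 0%E.
Proof. by apply: esum1 => x _; rewrite normc0 mul0r. Qed.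

Lemma wnorm_eq0 f : (wnorm f = 0)%E -> f = 0.
Proof.
move=> f0; apply/funext => x; apply: eq0_normc; apply/eqP.
have := le_esumr_term x (wn0 f); rewrite -/(wnorm f) f0 lee_fin.
by rewrite pmulr_lle0 ?weight_gt0// => nf; rewrite eq_le nf normc_ge0.
Qed.

Let w_split x y : w x <= w y * w (y^-1 * x)%g.
Proof. by rewrite -{1}(mul1g x) -{1}(mulgV y) -mulgA weightM. Qed.

Lemma conv_term f g x y :
  normc (f y * g (y^-1 * x)%g) * w x <= wn f y * wn g (y^-1 * x)%g.
Proof.
rewrite normcM /wn mulrACA ler_wpM2l//; by rewrite mulr_ge0 ?normc_ge0.
Qed.

Lemma summable_term f g : (wnorm f < +oo)%E -> (wnorm g < +oo)%E -> forall x,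
  abs_summable (fun y => f y * g (y^-1 * x)%g).
Proof.
move=> hf hg x; rewrite /abs_summable.
have := nnconv_lty (wn0 f) (wn0 g) hf hg x.
suff : (\esum_(y in [set: G]) (w x * normc (f y * g (y^-1 * x)%g))%:E <=
        nnconv (wn f) (wn g) x)%E.
  rewrite esumrZ//; last by move=> y; exact: normc_ge0.
  move=> le1 /(le_lt_trans le1) lt1.
  exact: mule_ltyl (weight_gt0 w x) lt1.
by apply: le_esum => y _; rewrite lee_fin mulrC conv_term.
Qed.

Lemma normc_conv f g x : (wnorm f < +oo)%E -> (wnorm g < +oo)%E ->
  ((normc (convolution f g x) * w x)%:E <= nnconv (wn f) (wn g) x)%E.
Proof.
move=> hf hg; rewrite mulrC EFinM.
apply: (@le_trans _ _ ((w x)%:E * \esum_(y in [set: G]) (normc (f y * g (y^-1 * x)%g))%:E)%E).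
  rewrite lee_wpmul2l ?lee_fin//; exact: csum_norm (summable_term hf hg x).
rewrite -esumrZ//; last by move=> y; exact: normc_ge0.
by apply: le_esum => y _; rewrite lee_fin mulrC conv_term.
Qed.

Lemma wnorm_conv f g : (wnorm f < +oo)%E -> (wnorm g < +oo)%E ->
  (wnorm (convolution f g) <= wnorm f * wnorm g)%E.
Proof.
move=> hf hg; rewrite -(esum_nnconv (wn0 f) (wn0 g) hf hg).
by apply: le_esum => x _; exact: normc_conv.
Qed.

Lemma wnorm_conv_lty f g : (wnorm f < +oo)%E -> (wnorm g < +oo)%E ->
  (wnorm (convolution f g) < +oo)%E.
Proof.
move=> hf hg; apply: le_lt_trans (esum_nnconv_lty (wn0 f) (wn0 g) hf hg).
by apply: le_esum => x _; exact: normc_conv.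
Qed.

Lemma convDl f1 f2 g : (wnorm f1 < +oo)%E -> (wnorm f2 < +oo)%E ->
  (wnorm g < +oo)%E ->
  convolution (f1 + f2) g = convolution f1 g + convolution f2 g.
Proof.
move=> h1 h2 hg; apply/funext => x; rewrite /convolution /=.
rewrite -[RHS]csumD; [|exact: summable_term|exact: summable_term].
by congr csum; apply/funext => y; rewrite -mulrDl.
Qed.

Lemma convDr f g1 g2 : (wnorm f < +oo)%E -> (wnorm g1 < +oo)%E ->
  (wnorm g2 < +oo)%E ->
  convolution f (g1 + g2) = convolution f g1 + convolution f g2.
Proof.
move=> hf h1 h2; apply/funext => x; rewrite /convolution /=.
rewrite -[RHS]csumD; [|exact: summable_term|exact: summable_term].
by congr csum; apply/funext => y; rewrite -mulrDr.
Qed.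

Lemma convZl c f g : (wnorm f < +oo)%E -> (wnorm g < +oo)%E ->
  convolution (fun x => c * f x) g = (fun x => c * convolution f g x).
Proof.
move=> hf hg; apply/funext => x; rewrite /convolution /=.
rewrite -[RHS]csumZ; last exact: summable_term.
by congr csum; apply/funext => y; rewrite mulrA.
Qed.

Lemma convZr c f g : (wnorm f < +oo)%E -> (wnorm g < +oo)%E ->
  convolution f (fun x => c * g x) = (fun x => c * convolution f g x).
Proof.
move=> hf hg; apply/funext => x; rewrite /convolution /=.
rewrite -[RHS]csumZ; last exact: summable_term.
by congr csum; apply/funext => y; rewrite mulrCA.
Qed.

Lemma convA f g h : (wnorm f < +oo)%E -> (wnorm g < +oo)%E ->
  (wnorm h < +oo)%E ->
  convolution f (convolution g h) = convolution (convolution f g) h.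
Proof.
move=> hf hg hh; apply/funext => x; rewrite {1 3}/convolution.
transitivity (csum (fun z => csum (fun y =>
    f z * g (z^-1 * y)%g * h (y^-1 * x)%g))).
  congr csum; apply/funext => z.
  rewrite /convolution -(csum_reindex _ (mulg_bij z^-1)) -csumZ.
    congr csum; apply/funext => y /=; rewrite mulrA; congr (_ * h _).
    by rewrite invgM invgK mulgA -(mulgA (y^-1)%g) mulgV mulg1.
  have := summable_term hg hh (z^-1 * x)%g.
  by rewrite /abs_summable (reindex_esum _ _ _ _ (mulg_bij z^-1)).
transitivity (csum (fun y => csum (fun z =>
    f z * g (z^-1 * y)%g * h (y^-1 * x)%g))).
  apply: csum_exchange.
  have e3 z y : 0 <= wn f z * wn g (z^-1 * y)%g * wn h (y^-1 * x)%g.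
    by rewrite !mulr_ge0 ?normc_ge0.
  have fg0 y : 0 <= fine (nnconv (wn f) (wn g) y).
    by rewrite fine_ge0// nnconv_ge0.
  have fgK y : (fine (nnconv (wn f) (wn g) y))%:E = nnconv (wn f) (wn g) y.
    by rewrite fineK// ge0_fin_numE ?nnconv_lty// nnconv_ge0.
  have fgoo : (\esum_(y in [set: G]) (fine (nnconv (wn f) (wn g) y))%:E < +oo)%E.
    under eq_esum do rewrite fgK.
    exact: esum_nnconv_lty.
  have := nnconv_lty fg0 (wn0 h) fgoo hh x.
  suff : ((w x)%:E * (\esum_(z in [set: G]) \esum_(y in [set: G])
      (normc (f z * g (z^-1 * y)%g * h (y^-1 * x)%g))%:E) <=
      nnconv (fun y => fine (nnconv (wn f) (wn g) y)) (wn h) x)%E.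
    by move=> le1 /(le_lt_trans le1); exact: mule_ltyl (weight_gt0 w x).
  rewrite esumr_pair; last by move=> *; exact: normc_ge0.
  rewrite -esumrZ//; last by move=> *; exact: normc_ge0.
  apply: (@le_trans _ _ (\esum_(k in [set: G * G])
      (wn f k.1 * wn g (k.1^-1 * k.2)%g * wn h (k.2^-1 * x)%g)%:E)%E).
    apply: le_esum => -[z y] _ /=; rewrite lee_fin mulrC.
    rewrite !normcM /wn.
    rewrite [leRHS](_ : _ = normc (f z) * normc (g (z^-1 * y)%g) *
      normc (h (y^-1 * x)%g) * (w z * w (z^-1 * y)%g * w (y^-1 * x)%g)); last by ring.
    rewrite ler_wpM2l ?mulr_ge0 ?normc_ge0//.
    by rewrite (le_trans (w_split x y))// ler_wpM2r.
  have bs : set_bij [set: G * G] [set: G * G] (fun k => (k.2, k.1)).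
    by split=> //= [[a b] [c d] _ _ [-> ->]//|[a b] _]; exists (b, a).
  rewrite (reindex_esum _ _ _ _ bs)/=.
  rewrite -(esumr_pair (a := fun y z => wn f z * wn g (z^-1 * y)%g * wn h (y^-1 * x)%g))//.
  apply: le_esum => y _; rewrite EFinM fgK muleC.
  under eq_esum do rewrite mulrC.
  by rewrite esumrZ// => z; rewrite mulr_ge0.
congr csum; apply/funext => y.
rewrite /convolution mulrC -csumZ; last exact: summable_term.
by congr csum; apply/funext => z; rewrite mulrC.
Qed.

End beurling.

(* Banach algebras are not assumed to be unital, hence not built on algType. *)
HB.mixin Record CompleteNormedModule_isBanachAlgebra (K : numFieldType) A
    of CompleteNormedModule K A := {
  bmul : A -> A -> A;
  bmulA : associative bmul;
  bmulDl : left_distributive bmul +%R;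
  bmulDr : right_distributive bmul +%R;
  bscalerAl : forall (c : K) (a b : A), c *: bmul a b = bmul (c *: a) b;
  bscalerAr : forall (c : K) (a b : A), c *: bmul a b = bmul a (c *: b);
  ler_bmul : forall a b : A, `|bmul a b| <= `|a| * `|b|
}.

#[short(type="banachAlgType")]
HB.structure Definition BanachAlgebra (K : numFieldType) :=
  {A of CompleteNormedModule K A & CompleteNormedModule_isBanachAlgebra K A}.

Section dual.
Context (R : realType) (V : normedModType R[i]).

Definition dual_pred : {pred V -> R[i]^o} :=
  [pred f : V -> R[i]^o | `[< linear f /\ continuous f >]].

(* The topological dual A^*; R[i]^o carries the norm topology of the scalars. *)
Record dual := Dual {
  dual_fun :> V -> R[i]^o;
  _ : dual_fun \in dual_pred
}.

HB.instance Definition _ := [isSub for dual_fun].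
HB.instance Definition _ := [Choice of dual by <:].

Lemma dual_linear (f : dual) : linear f.
Proof. by have /asboolP[] := valP f. Qed.

Lemma dual_continuous (f : dual) : continuous f.
Proof. by have /asboolP[] := valP f. Qed.

HB.instance Definition _ (f : dual) :=
  GRing.isLinear.Build R[i] V R[i]^o *:%R f (dual_linear f).

Lemma dual_submod_closed : submod_closed dual_pred.
Proof.
split=> [|c f g /asboolP[lf cf] /asboolP[lg cg]]; apply/asboolP; split.
- by move=> a x y; rewrite scaler0 addr0.
- exact: cst_continuous.
- move=> a x y; rewrite !fctE lf lg !scalerDr addrACA.
  by congr (_ + _ + _); rewrite !scalerA mulrC.
- move=> x; apply: cvgD; last exact: cg.
  by apply: cvgZr; exact: cf.
Qed.

HB.instance Definition _ := GRing.isSubmodClosed.Build _ _ dual_pred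
  dual_submod_closed.

HB.instance Definition _ := [SubChoice_isSubLmodule of dual by <:].

(* The operator norm. The library's norms take values in the scalar field, so
   the norm on dual is the image (dual_norm f)%:C of this real number. *)
Definition dual_norm (f : dual) : R :=
  sup [set normc (f x) | x in [set x | `|x| <= 1]].

Let C_ge0 (z : R[i]) : 0 <= z -> z = (Re z)%:C.
Proof. by case: z => x y; rewrite lecE /= => /andP[/eqP -> _]. Qed.

Lemma dual_bounded (f : dual) :
  exists2 M : R, 0 <= M & forall x, `|f x| <= M%:C * `|x|.
Proof.
have /linear_bounded_continuous/linear_boundedP := @dual_continuous f.
move=> /pinfty_ex_gt0[M M0 fM]; exists (Re M) => [|x].
  by move: (ltW M0); rewrite lecE/= => /andP[].
by rewrite -(C_ge0 (ltW M0)); exact: fM.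
Qed.

Lemma dual_has_sup (f : dual) :
  has_sup [set normc (f x) | x in [set x | `|x| <= 1]].
Proof.
split; first by exists (normc (f 0)); exists 0 => //=; rewrite normr0.
have [M M0 fM] := dual_bounded f; exists M => _ [x /= x1 <-].
rewrite -lecR -normcE (le_trans (fM x))// -[leRHS]mulr1 ler_wpM2l//.
by rewrite lecR.
Qed.

Lemma dual_norm_ge0 (f : dual) : 0 <= dual_norm f.
Proof.
have : normc (f 0) <= dual_norm f.
  by apply: (sup_upper_bound (dual_has_sup f)); exists 0 => //=; rewrite normr0.
by rewrite linear0 normc0.
Qed.

Lemma ler_dual_norm (f : dual) x : `|f x| <= (dual_norm f)%:C * `|x|.
Proof.
have [->|x0] := eqVneq x 0; first by rewrite linear0 !normr0 mulr0.
have nx : 0 < `|x| by rewrite normr_gt0.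
rewrite -ler_pdivrMr//.
have -> : `|f x| / `|x| = `|f (`|x|^-1 *: x)|.
  rewrite linearZ /= normrM mulrC; congr (_ * _).
  by rewrite normfV normr_id.
rewrite normcE lecR; apply: (sup_upper_bound (dual_has_sup f)).
by exists (`|x|^-1 *: x) => //=; rewrite normrZ normfV normr_id mulVf ?gt_eqF.
Qed.

Lemma dual_norm_le (f : dual) (M : R) :
  (forall x, `|x| <= 1 -> `|f x| <= M%:C) -> dual_norm f <= M.
Proof.
move=> fM; apply: ge_sup; first exact: (dual_has_sup f).1.
by move=> _ [x /= x1 <-]; rewrite -lecR -normcE fM.
Qed.

Lemma dual_normD (f g : dual) :
  (dual_norm (f + g))%:C <= (dual_norm f)%:C + (dual_norm g)%:C.
Proof.
rewrite -rmorphD/= lecR; apply: dual_norm_le => x x1.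
apply: le_trans (ler_normD _ _) _; rewrite rmorphD/= lerD//.
- apply: le_trans (ler_dual_norm f x) _.
  by rewrite -[leRHS]mulr1 ler_wpM2l// lecR dual_norm_ge0.
- apply: le_trans (ler_dual_norm g x) _.
  by rewrite -[leRHS]mulr1 ler_wpM2l// lecR dual_norm_ge0.
Qed.

Lemma dual_norm_eq0 (f : dual) : (dual_norm f)%:C = 0 -> f = 0.
Proof.
move=> f0; apply/val_inj/funext => x /=.
by apply/eqP; rewrite -normr_le0 (le_trans (ler_dual_norm f x))// f0 mul0r.
Qed.

Lemma dual_normZ (c : R[i]) (f : dual) :
  (dual_norm (c *: f))%:C = `|c| * (dual_norm f)%:C.
Proof.
have le1 (d : R[i]) (g : dual) : dual_norm (d *: g) <= normc d * dual_norm g.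
  apply: dual_norm_le => x x1; rewrite /= normrM rmorphM ler_wpM2l//.
  apply: le_trans (ler_dual_norm g x) _.
  by rewrite -[leRHS]mulr1 ler_wpM2l// lecR dual_norm_ge0.
rewrite normcE -rmorphM/=; congr (_%:C); apply/eqP; rewrite eq_le le1/=.
have [->|c0] := eqVneq c 0; first by rewrite normc0 mul0r dual_norm_ge0.
have nc : normc c != 0 by apply: contra c0 => /eqP/eq0_normc/eqP.
have nc0 : 0 < normc c by rewrite lt_def nc normc_ge0.
have := le1 c^-1 (c *: f); rewrite scalerA mulVf// scale1r normcV.
by rewrite -ler_pdivlMl ?invr_gt0// invrK.
Qed.

HB.instance Definition _ :=
  Lmodule_isNormed.Build R[i] dual dual_normD dual_normZ dual_norm_eq0.

End dual.

Section amenability.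
Context (R : realType) (A : banachAlgType R[i]).

Lemma lact_subproof (a : A) (f : dual A) :
  (fun x => f (bmul x a)) \in @dual_pred R A.
Proof.
apply/asboolP; set g := (X in linear X).
have lg : linear g.
  by move=> c x y; rewrite /g bmulDl -bscalerAl linearP.
split => //.
pose gL : {linear A -> R[i]^o} :=
  HB.pack g (GRing.isLinear.Build R[i] A R[i]^o *:%R g lg).
apply: (@bounded_linear_continuous _ _ _ gL).
apply/ex_bound; exists ((dual_norm f)%:C * `|a|).
apply/nbhs_norm0P; exists 1 => //= x /= x1.
apply: le_trans (ler_dual_norm f _) _.
rewrite ler_wpM2l ?lecR ?dual_norm_ge0//.
apply: le_trans (ler_bmul _ _) _.
by rewrite -[leRHS]mul1r ler_wpM2r// ltW.
Qed.

Lemma ract_subproof (a : A) (f : dual A) :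
  (fun x => f (bmul a x)) \in @dual_pred R A.
Proof.
apply/asboolP; set g := (X in linear X).
have lg : linear g.
  by move=> c x y; rewrite /g bmulDr -bscalerAr linearP.
split => //.
pose gL : {linear A -> R[i]^o} :=
  HB.pack g (GRing.isLinear.Build R[i] A R[i]^o *:%R g lg).
apply: (@bounded_linear_continuous _ _ _ gL).
apply/ex_bound; exists ((dual_norm f)%:C * `|a|).
apply/nbhs_norm0P; exists 1 => //= x /= x1.
apply: le_trans (ler_dual_norm f _) _.
rewrite ler_wpM2l ?lecR ?dual_norm_ge0//.
apply: le_trans (ler_bmul _ _) _.
by rewrite -[leRHS]mulr1 ler_wpM2l// ltW.
Qed.

(* <x, a.f> = <xa, f> and <x, f.a> = <ax, f> *)
Definition lact (a : A) (f : dual A) : dual A := Dual (lact_subproof a f).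
Definition ract (f : dual A) (a : A) : dual A := Dual (ract_subproof a f).

Definition derivation (D : A -> dual A) : Prop :=
  linear D /\ forall a b, D (bmul a b) = lact a (D b) + ract (D a) b.

Definition inner (D : A -> dual A) : Prop :=
  exists f : dual A, forall a, D a = lact a f - ract f a.

Definition weakly_amenable : Prop :=
  forall D : A -> dual A, derivation D -> continuous D -> inner D.

End amenability.

Section ell1.
Context (R : realType) (G : groupType) (w : weight R G).

Definition ell1_pred : {pred G -> R[i]} :=
  [pred f : G -> R[i] | (wnorm w f < +oo)%E].

Record ell1 := Ell1 { ell1_fun :> G -> R[i]; _ : ell1_fun \in ell1_pred }.

HB.instance Definition _ := [isSub for ell1_fun].
HB.instance Definition _ := [Choice of ell1 by <:].

Lemma ell1_lty (f : ell1) : (wnorm w f < +oo)%E.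
Proof. exact: (valP f). Qed.

Lemma ell1_submod_closed : submod_closed ell1_pred.
Proof.
split=> [|c f g]; rewrite !inE; first by rewrite wnorm0 ltry.
move=> hf hg; apply: le_lt_trans (wnormD w _ _) _.
rewrite lte_add_pinfty// (wnormZ w c f).
by rewrite lte_mul_pinfty// lee_fin normc_ge0.
Qed.

HB.instance Definition _ := GRing.isSubmodClosed.Build _ _ ell1_pred
  ell1_submod_closed.

HB.instance Definition _ := [SubChoice_isSubLmodule of ell1 by <:].

Definition ell1_norm (f : ell1) : R := fine (wnorm w f).

Lemma ell1_normK (f : ell1) : (ell1_norm f)%:E = wnorm w f.
Proof. by rewrite fineK// wnorm_fin// ell1_lty. Qed.

Lemma ell1_normD (f g : ell1) :
  (ell1_norm (f + g))%:C <= (ell1_norm f)%:C + (ell1_norm g)%:C.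
Proof.
by rewrite -rmorphD/= lecR -lee_fin EFinD !ell1_normK; exact: wnormD.
Qed.

Lemma ell1_normZ (c : R[i]) (f : ell1) :
  (ell1_norm (c *: f))%:C = `|c| * (ell1_norm f)%:C.
Proof.
rewrite normcE -rmorphM/=; congr (_%:C); apply: EFin_inj.
by rewrite EFinM !ell1_normK; exact: wnormZ.
Qed.

Lemma ell1_norm_eq0 (f : ell1) : (ell1_norm f)%:C = 0 -> f = 0.
Proof.
move=> [f0]; apply/val_inj/(@wnorm_eq0 _ _ w).
by rewrite -ell1_normK f0.
Qed.

HB.instance Definition _ :=
  Lmodule_isNormed.Build R[i] ell1 ell1_normD ell1_normZ ell1_norm_eq0.

Lemma ell1_normE (f : ell1) : `|f| = (ell1_norm f)%:C.
Proof. by []. Qed.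

Lemma ell1_fset_sum (f : ell1) (X : {fset G}) :
  \sum_(x <- X) normc (f x) * w x <= ell1_norm f.
Proof.
rewrite -lee_fin ell1_normK -sumEFin /wnorm; apply: esum_ge; exists [set` X].
  by split => //; exact: finite_fset.
by rewrite fsbig_finite//= set_fsetK.
Qed.

Lemma ell1_coord (f : ell1) x : normc (f x) * w x <= ell1_norm f.
Proof. by have := ell1_fset_sum f [fset x]%fset; rewrite big_seq_fset1. Qed.

Lemma ell1_complete (F : set_system ell1) : ProperFilter F -> cauchy F -> cvg F.
Proof.
move=> FF /cauchyP F_cauchy.
have w0 x : 0 <= w x by exact/ltW/weight_gt0.
have Fball (e : R) : 0 < e -> exists f, F [set g | ell1_norm (f - g) < e].
  move=> e0; have := F_cauchy e%:C; rewrite ltcR => /(_ e0)[f Ff].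
  exists f; apply: filterS Ff => g; rewrite -ball_normE /=.
  by rewrite ell1_normE ltcR.
have cre (p : ell1 -> R) (C : R) : 0 < C ->
    (forall f g, `|p f - p g| * C <= ell1_norm (f - g)) -> cvg (p @ F).
  move=> C0 pC; apply: R_complete; apply/cauchyP => e e0.
  have [f Ff] := Fball (e * C) (mulr_gt0 e0 C0).
  exists (p f); suff : F (p @^-1` ball (p f) e) by [].
  apply: filterS Ff => g /= fg; rewrite -ball_normE/=.
  by rewrite -(ltr_pM2r C0) (le_lt_trans (pC f g)).
have cr x : cvg ((fun f : ell1 => Re (f x)) @ F).
  apply: (cre _ (w x)); first exact: weight_gt0.
  move=> f g; apply: le_trans (ell1_coord (f - g) x).
  by rewrite ler_wpM2r// -raddfB; exact: normc_Re.
have ci x : cvg ((fun f : ell1 => Im (f x)) @ F).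
  apply: (cre _ (w x)); first exact: weight_gt0.
  move=> f g; apply: le_trans (ell1_coord (f - g) x).
  by rewrite ler_wpM2r// -raddfB; exact: normc_Im.
pose l x : R[i] := lim ((fun f : ell1 => Re (f x)) @ F) +i*
                   lim ((fun f : ell1 => Im (f x)) @ F).
have normc_le (z : R[i]) : normc z <= `|Re z| + `|Im z|.
  rewrite -lecR -normcE {1}(complexE z) rmorphD/= (le_trans (ler_normD _ _))//.
  rewrite normrM; have -> : `|'i : R[i]| = 1.
    by rewrite normcE /= expr0n expr1n add0r sqrtr1.
  rewrite mul1r !normcE /= !expr0n /= !addr0 !sqrtr_sqr.
  by [].
have lF x (e : R) : 0 < e -> F [set g : ell1 | normc (l x - g x) < e].
  move=> e0; have e20 : 0 < e / 2 by rewrite divr_gt0.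
  have /cvgrPdist_lt/(_ _ e20) hr := cr x.
  have /cvgrPdist_lt/(_ _ e20) hi := ci x.
  apply: filterS2 hr hi => g /= hr hi.
  rewrite /= (le_lt_trans (normc_le _))// [ltRHS](splitr e) !raddfB/=.
  exact: ltrD.
have le_l (e : R) (f : ell1) : F [set g | ell1_norm (f - g) < e] ->
    (wnorm w (fun x => f x - l x)%R <= e%:E)%E.
  move=> Ffe; rewrite /wnorm; apply: ge_ereal_sup => _ [A [finA _] <-].
  rewrite fsbig_finite//= sumEFin lee_fin; apply/ler_addgt0Pr => d d0.
  set X := fset_set A; pose M := \sum_(x <- X) w x + 1.
  have M0 : 0 < M by rewrite ltr_wpDl// sumr_ge0.
  have FX : F [set g : ell1 | forall x, x \in X -> normc (l x - g x) < d / M].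
    have : F (\bigcap_(x in [set` X]) [set g : ell1 | normc (l x - g x) < d / M]).
      by apply: filter_bigI => x _; apply: lF; rewrite divr_gt0.
    by apply: filterS => g h x xX; exact: h.
  have [g [/= ge gX]] := filter_ex (filterI Ffe FX).
  apply: (@le_trans _ _ (\sum_(x <- X) (normc (f x - g x) * w x + d / M * w x))).
    rewrite !big_seq; apply: ler_sum => x xX.
    rewrite -mulrDl ler_wpM2r//.
    have -> : f x - l x = (f x - g x) + (g x - l x) by rewrite addrA subrK.
    rewrite (le_trans (normcD _ _))// lerD2l.
    have -> : normc (g x - l x) = normc (l x - g x).
      by apply: complexI; rewrite -!normcE distrC.
    exact/ltW/gX.
  rewrite big_split/= -mulr_sumr lerD//.
    by apply: le_trans (ell1_fset_sum (f - g) X) _; exact: ltW.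
  rewrite mulrAC ler_pdivrMr// ler_pM2l// /M lerDl//.
have fl (e : R) (f : ell1) : F [set g | ell1_norm (f - g) < e] ->
    (fun x => f x - l x) \in ell1_pred.
  by move=> Ffe; rewrite inE (le_lt_trans (le_l _ _ Ffe))// ltry.
have [f0 Ff0] := Fball 1 ltr01.
have lE : l = ell1_fun (f0 - Ell1 (fl _ _ Ff0)).
  by apply/funext => x /=; rewrite !fctE subKr.
pose L := f0 - Ell1 (fl _ _ Ff0).
have Lf (e : R) (f : ell1) : F [set g | ell1_norm (f - g) < e] ->
    ell1_norm (f - L) <= e.
  move=> /le_l; rewrite -lee_fin ell1_normK; congr (wnorm w _ <= _)%E.
  by rewrite lE.
apply/cvg_ex; exists L; apply/cvgrPdist_lt => e e0.
have [a a0 ->] : exists2 a : R, 0 < a & e = a%:C.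
  by case: e e0 => a b; rewrite ltcE/= => /andP[/eqP b0 a0]; exists a; rewrite // b0.
have a20 : 0 < a / 2 by rewrite divr_gt0.
have [f Ff] := Fball _ a20.
apply: filterS (Ff) => g /= fg.
rewrite -(subrKA f) ell1_normE ltcR (splitr a).
have -> : L - f + (f - g) = (f - g) - (f - L).
  by rewrite opprB addrC.
rewrite -ltcR -ell1_normE (le_lt_trans (ler_normB _ _))//.
by rewrite rmorphD/= !ell1_normE ltr_leD ?ltcR ?lecR// Lf.
Qed.

HB.instance Definition _ := Uniform_isComplete.Build ell1 ell1_complete.

Lemma ell1_mul_subproof (f g : ell1) : convolution f g \in ell1_pred.
Proof. by rewrite inE; apply: wnorm_conv_lty; exact: ell1_lty. Qed.

Definition ell1_mul (f g : ell1) : ell1 := Ell1 (ell1_mul_subproof f g).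

Lemma ell1_mulA : associative ell1_mul.
Proof. by move=> f g h; apply/val_inj/(@convA _ _ w); exact: ell1_lty. Qed.

Lemma ell1_mulDl : left_distributive ell1_mul +%R.
Proof. by move=> f g h; apply/val_inj/(@convDl _ _ w); exact: ell1_lty. Qed.

Lemma ell1_mulDr : right_distributive ell1_mul +%R.
Proof. by move=> f g h; apply/val_inj/(@convDr _ _ w); exact: ell1_lty. Qed.

Lemma ell1_scaleAl (c : R[i]) (f g : ell1) :
  c *: ell1_mul f g = ell1_mul (c *: f) g.
Proof.
by apply/val_inj/esym/(@convZl _ _ w); exact: ell1_lty.
Qed.

Lemma ell1_scaleAr (c : R[i]) (f g : ell1) :
  c *: ell1_mul f g = ell1_mul f (c *: g).
Proof.
by apply/val_inj/esym/(@convZr _ _ w); exact: ell1_lty.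
Qed.

Lemma ler_ell1_mul (f g : ell1) : `|ell1_mul f g| <= `|f| * `|g|.
Proof.
rewrite !ell1_normE -rmorphM/= lecR -lee_fin EFinM !ell1_normK.
by apply: wnorm_conv; exact: ell1_lty.
Qed.

HB.instance Definition _ := CompleteNormedModule_isBanachAlgebra.Build R[i] ell1
  ell1_mulA ell1_mulDl ell1_mulDr ell1_scaleAl ell1_scaleAr ler_ell1_mul.

End ell1.

Section ax_plus_b.
Context (R : realType).

(* pairs (a, b) with a > 0, and (a, b)(c, d) = (a c, a d + b) *)
Record axb := Axb { axb_val :> R * R; _ : 0 < axb_val.1 }.

HB.instance Definition _ := [isSub for axb_val].
HB.instance Definition _ := [Choice of axb by <:].

Implicit Types x y : axb.

Lemma axb_gt0 x : 0 < x.1.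
Proof. exact: valP x. Qed.

Lemma axb_mul_subproof x y : 0 < (x.1 * y.1, x.1 * y.2 + x.2).1.
Proof. by rewrite mulr_gt0 ?axb_gt0. Qed.

Lemma axb_inv_subproof x : 0 < (x.1^-1, - (x.1^-1 * x.2)).1.
Proof. by rewrite invr_gt0 axb_gt0. Qed.

Definition axb_mul x y : axb := Axb (axb_mul_subproof x y).
Definition axb_one : axb := @Axb (1, 0) ltr01.
Definition axb_inv x : axb := Axb (axb_inv_subproof x).

Lemma axb_mulA : associative axb_mul.
Proof. by move=> x y z; apply/val_inj; congr (_, _) => /=; ring. Qed.

Lemma axb_mul1g : left_id axb_one axb_mul.
Proof.
by move=> x; apply/val_inj; case: x => -[a b] ? /=; congr (_, _); ring.
Qed.

Lemma axb_mulg1 : right_id axb_one axb_mul.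
Proof.
by move=> x; apply/val_inj; case: x => -[a b] ? /=; congr (_, _); ring.
Qed.

Lemma axb_mulVg : left_inverse axb_one axb_inv axb_mul.
Proof.
move=> x; apply/val_inj; congr (_, _) => /=; last by rewrite subrr.
by rewrite mulVf// gt_eqF// axb_gt0.
Qed.

Lemma axb_mulgV : right_inverse axb_one axb_inv axb_mul.
Proof.
have x0 x : x.1 != 0 by rewrite gt_eqF// axb_gt0.
move=> x; apply/val_inj; congr (_, _) => /=; first by rewrite divff.
by rewrite mulrN mulVKf// addNr.
Qed.

HB.instance Definition _ :=
  isGroup.Build axb axb_mulA axb_mul1g axb_mulg1 axb_mulVg axb_mulgV.

Definition Hb : set axb := [set x | x.1 = 1].

End ax_plus_b.

Definition diagonally_bounded (R : realType) (G : groupType) (w : weight R G) :=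
  has_ubound [set w x * w x^-1%g | x in [set: G]].

(* Main.v *)
(* If w is diagonally bounded and bounded below, it is bounded, so a derivation D
   is determined by the bounded function c(x, z) = <delta_z, D delta_x>; the
   pointwise supremum over x of c(x, x^-1 y), taken for the real and imaginary
   parts, is bounded and implements D (the argument of Despic and Ghahramani).

   Conversely put V(t) = w(e^t, 0) w(e^-t, 0).  As w is bounded on H_b, V is
   unbounded as soon as w is not diagonally bounded.  Let F(1, b) = ln V(ln b)
   for b > 0 and F = 0 elsewhere.  Since ln V is even and subadditive,
   |F(zx) - F(xz)| is at most a multiple of w(z) w(x), so the coboundary of F
   extends to a continuous derivation.  If it were the coboundary of some f with
   f / w bounded, then F - f would be constant on the class {(1, b) : b > 0}, on
   which f is bounded, and V would be bounded. *)
From HB Require Import structures.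
Require Import Defs.
From mathcomp Require Import all_boot all_order all_algebra.
From mathcomp Require Import complex finmap.
From mathcomp Require Import all_classical all_reals all_analysis.
From mathcomp Require Import ring lra.
Set Implicit Arguments.
Unset Strict Implicit.
Unset Printing Implicit Defensive.
Import Order.TTheory GRing.Theory Num.Theory.
Import numFieldNormedType.Exports.
Import ComplexField.Normc.
Local Open Scope classical_set_scope.
Local Open Scope ring_scope.
Local Open Scope complex_scope.

Local Notation Re := (@complex.Re _).
Local Notation Im := (@complex.Im _).

(** * Sums with at most one nonzero term *)

Section single_term.
Context {R : realType} {T : choiceType}.

Lemma esum_single (a : T -> \bar R) x : (0 <= a x)%E ->
  (forall y, y != x -> a y = 0%E) -> \esum_(y in [set: T]) a y = a x.
Proof.
move=> a0 ax; rewrite -[RHS](esum_set1 a0) [RHS]esum_mkcond.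
apply: eq_esum => y _; case: ifPn => //.
by rewrite notin_setE /= => /eqP/ax.
Qed.

Lemma rsum_single (a : T -> R) x : (forall y, y != x -> a y = 0) -> rsum a = a x.
Proof.
move=> ax; rewrite /rsum !(esum_single (x := x)) ?funepos_ge0 ?funeneg_ge0//.
- rewrite funeposE funenegE /= -!EFin_max /=.
  by case: (leP (a x) 0) => ?; case: leP => ? /=; lra.
- by move=> y /ax /= h; rewrite funenegE /= h oppr0 maxxx.
- by move=> y /ax /= h; rewrite funeposE /= h maxxx.
Qed.

Lemma csum_single (f : T -> R[i]) x : (forall y, y != x -> f y = 0) -> csum f = f x.
Proof.
move=> fx; rewrite /csum !(rsum_single (x := x)) /=; first by case: (f x).
- by move=> y /fx /= ->.
- by move=> y /fx /= ->.
Qed.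

End single_term.

(** * Point masses in the weighted algebra *)

Section delta.
Context {R : realType} {G : groupType} {w : weight R G}.

Lemma delta_subproof x : (fun y : G => (y == x)%:R : R[i]) \in ell1_pred w.
Proof.
rewrite inE /wnorm (esum_single (x := x)) ?ltry//.
- by rewrite lee_fin mulr_ge0 ?normc_ge0// ltW// weight_gt0.
- by move=> y /negbTE ->; rewrite normc0 mul0r.
Qed.

Definition delta x : ell1 w := Ell1 (delta_subproof x).

Lemma ell1_norm_delta x : ell1_norm (delta x) = w x.
Proof.
rewrite /ell1_norm /wnorm (esum_single (x := x)) /=.
- by rewrite eqxx normc1 mul1r.
- by rewrite lee_fin mulr_ge0 ?normc_ge0// ltW// weight_gt0.
- by move=> y /negbTE ->; rewrite normc0 mul0r.
Qed.

Lemma delta_mul x y : bmul (delta x) (delta y) = delta (x * y)%g.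
Proof.
apply/val_inj/funext => z /=; rewrite /convolution (csum_single (x := x)) /=.
  by rewrite eqxx mul1r -(inj_eq (mulgI x)) mulgA mulgV mul1g.
by move=> t /negbTE ->; rewrite mul0r.
Qed.

Lemma ell1_norm_ge0 (u : ell1 w) : 0 <= ell1_norm u.
Proof. by rewrite fine_ge0// wnorm_ge0. Qed.

End delta.

(** * Density of finitely supported functions *)

Section density.
Context {R : realType} {G : groupType} {w : weight R G}.

(** Truncate [u] to a finite set whose partial sum comes within [e] of the supremum defining the
    norm; the error is the tail. *)
Lemma ell1_approx (u : ell1 w) (e : R) : 0 < e ->
  exists (s : seq G) (v : ell1 w), (forall x, x \notin s -> v x = 0) /\
    ell1_norm (u - v) < e.
Proof.
move=> e0; have w0 x : 0 <= w x by exact/ltW/weight_gt0.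
have t0 x : (0 <= (normc (u x) * w x)%:E)%E.
  by rewrite lee_fin mulr_ge0 ?normc_ge0.
have := ub_ereal_sup_adherent e0 (wnorm_fin (ell1_lty u)).
move=> [_ [A [finA _] <-]]; rewrite -[ereal_sup _]/(wnorm w u) => lt_A.
have vP : (fun x => if x \in A then u x else 0) \in ell1_pred w.
  rewrite inE (le_lt_trans _ (ell1_lty u))//; apply: le_esum => x _.
  by rewrite lee_fin; case: ifP => // _; rewrite normc0 mul0r mulr_ge0 ?normc_ge0.
exists (fset_set A), (Ell1 vP); split=> [x|].
  by rewrite in_fset_set//= => /negbTE ->.
rewrite -lte_fin ell1_normK.
have -> : wnorm w (u - Ell1 vP) = (\esum_(x in ~` A) (normc (u x) * w x)%:E)%E.
  rewrite [RHS]esum_mkcond; apply: eq_esum => x _ /=; rewrite in_setC !fctE /=.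
  by case: ifP => _ /=; rewrite ?subrr ?normc0 ?mul0r ?subr0.
rewrite -esum_fset // in lt_A.
have := esumID A [set: G] _ (fun x _ => t0 x).
rewrite !setTI -/(wnorm w u) => uE.
have Afin : (\esum_(x in A) (normc (u x) * w x)%:E)%E \is a fin_num.
  rewrite ge0_fin_numE ?esum_ge0// (le_lt_trans _ (ell1_lty u))//.
  by rewrite uE leeDl// esum_ge0.
by move: lt_A; rewrite uE lteBlDr// lteD2lE.
Qed.

Lemma ell1_finsupp_eq0 (V : lmodType R[i]) (phi : ell1 w -> V) :
  linear phi -> (forall x, phi (delta x) = 0) ->
  forall (s : seq G) (v : ell1 w), (forall x, x \notin s -> v x = 0) ->
  phi v = 0.
Proof.
move=> lin phi0; pose phiL : {linear ell1 w -> V} :=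
  HB.pack phi (GRing.isLinear.Build R[i] (ell1 w) V *:%R phi lin).
elim=> [v v0|x s IHs v vs].
  have -> : v = 0 by apply/val_inj/funext => x; exact: v0.
  exact: (linear0 phiL).
have -> : v = v x *: delta x + (v - v x *: delta x) by rewrite addrC subrK.
rewrite lin phi0 scaler0 add0r; apply: IHs => y ys /=; rewrite !fctE /=.
have [->|yx] := eqVneq y x; first by rewrite [_ *: _]mulr1 subrr.
by rewrite [_ *: _]mulr0 subr0 vs// inE negb_or yx.
Qed.

(** Taking a bare function with a bound, not an element of [dual], lets it apply directly to
    expressions such as [D a u] in either variable. *)
Lemma ell1_dense (phi : ell1 w -> R[i]) (M : R) :
  (forall c u v, phi (c *: u + v) = c * phi u + phi v) ->
  (forall u, normc (phi u) <= M * ell1_norm u) ->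
  (forall x, phi (delta x) = 0) -> forall u, phi u = 0.
Proof.
move=> lin phiM phi0 u; apply/eq0_normc/eqP.
rewrite eq_le normc_ge0 andbT; apply/ler_addgt0Pr => e e0.
have M0 : 0 < `|M| + 1 by rewrite ltr_wpDl.
have [s [v [vs uv]]] := ell1_approx u (divr_gt0 e0 M0).
have -> : u = 1 *: (u - v) + v by rewrite scale1r subrK.
rewrite lin (ell1_finsupp_eq0 (V := R[i]^o) lin phi0 vs) addr0 mul1r add0r.
apply: le_trans (phiM _) _.
apply: (@le_trans _ _ ((`|M| + 1) * ell1_norm (u - v))).
  by rewrite ler_wpM2r ?ell1_norm_ge0// (le_trans (ler_norm M))// lerDl.
by rewrite mulrC -ler_pdivlMr// ltW.
Qed.

End density.

(** * Functionals given by functions dominated by the weight *)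

Section bounded_functions.
Context {R : realType}.

Lemma bounded_linear_cts (V W : normedModType R[i]) (f : V -> W) (M : R) :
  linear f -> (forall x, `|f x| <= M%:C * `|x|) -> continuous f.
Proof.
move=> lin fM; pose fL : {linear V -> W} :=
  HB.pack f (GRing.isLinear.Build R[i] V W *:%R f lin).
apply: (@bounded_linear_continuous _ _ _ fL).
apply/ex_bound; exists `|M|%:C; apply/nbhs_norm0P; exists 1 => //= x /= x1.
apply: le_trans (fM x) _; apply: (@le_trans _ _ (`|M|%:C * `|x|)).
  by rewrite ler_wpM2r// lecR ler_norm.
by rewrite -[leRHS]mulr1 ler_wpM2l ?lecR// ltW.
Qed.

Lemma cts_linear_bounded (V W : normedModType R[i]) (f : V -> W) :
  linear f -> continuous f ->
  exists M : R, forall x, `|f x| <= M%:C * `|x|.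
Proof.
move=> lin cf; pose fL : {linear V -> W} :=
  HB.pack f (GRing.isLinear.Build R[i] V W *:%R f lin).
have /linear_bounded_continuous/linear_boundedP : continuous fL := cf.
move=> /pinfty_ex_gt0[[a b] M0 fM]; exists a => x.
(* A positive element of [R[i]] has zero imaginary part, so the bound can be taken real. *)
have -> : a%:C = a +i* b by move: M0; rewrite ltcE /= => /andP[/eqP ->].
exact: fM.
Qed.

Context {G : groupType} {w : weight R G}.

Definition pairing (h : G -> R[i]) (u : ell1 w) : R[i] := csum (fun x => u x * h x).

Section pairing.
Variables (h : G -> R[i]) (M : R).
Hypothesis hM : forall x, normc (h x) <= M * w x.

Let M0 : 0 <= M.
Proof.
by rewrite -(pmulr_lge0 _ (weight_gt0 w 1%g)) (le_trans (normc_ge0 _) (hM 1%g)).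
Qed.

Lemma pairing_esum (u : ell1 w) :
  (\esum_(x in [set: G]) (normc (u x * h x))%:E <= (M * ell1_norm u)%:E)%E.
Proof.
rewrite EFinM ell1_normK /wnorm -esumrZ//; last first.
  by move=> x; rewrite mulr_ge0 ?normc_ge0// ltW// weight_gt0.
apply: le_esum => x _; rewrite lee_fin normcM mulrCA.
by rewrite ler_wpM2l ?normc_ge0.
Qed.

Lemma pairing_summable (u : ell1 w) : abs_summable (fun x => u x * h x).
Proof. by apply: le_lt_trans (pairing_esum u) _; exact: ltry. Qed.

Lemma normc_pairing (u : ell1 w) : normc (pairing h u) <= M * ell1_norm u.
Proof.
by rewrite -lee_fin (le_trans (csum_norm (pairing_summable u)))// pairing_esum.
Qed.

Lemma pairing_linear : linear (pairing h : ell1 w -> R[i]^o).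
Proof.
move=> c u v; have hu := pairing_summable u; have hv := pairing_summable v.
transitivity (c * pairing h u + pairing h v); last by [].
rewrite /pairing -csumZ// -csumD//; last exact: abs_summableZ.
by congr csum; apply/funext => x /=; rewrite mulrA -mulrDl.
Qed.

Lemma pairing_delta x : pairing h (delta x) = h x.
Proof.
rewrite /pairing (csum_single (x := x)) /= ?eqxx ?mul1r//.
by move=> y /negbTE ->; rewrite mul0r.
Qed.

(** Existence half of the identification of the dual with the functions [h] such that [h / w] is
    bounded; [dual_ext] gives uniqueness. *)
Lemma functional_exists : exists f : dual (ell1 w),
  (forall x, f (delta x) = h x) /\
  (forall u, normc (f u) <= M * ell1_norm u).
Proof.
have hdual : pairing h \in @dual_pred R (ell1 w).
  apply/asboolP; split; first exact: pairing_linear.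
  apply: (bounded_linear_cts (M := M)); first exact: pairing_linear.
  move=> u; rewrite ell1_normE -rmorphM/= -[leLHS]/((normc (pairing h u))%:C).
  by rewrite lecR normc_pairing.
exists (Dual hdual); split; [exact: pairing_delta|exact: normc_pairing].
Qed.

End pairing.
End bounded_functions.

(** * Identities checked on point masses *)

Section duals.
Context {R : realType} {G : groupType} {w : weight R G}.
Implicit Types f g : dual (ell1 w).

Lemma dualDE f g u : (f + g) u = f u + g u.
Proof. by []. Qed.

Lemma dualNE f u : (- f) u = - f u.
Proof. by []. Qed.

Lemma dualZE c f u : (c *: f) u = c * f u.
Proof. by []. Qed.

Lemma dualPE f c u v : f (c *: u + v) = c * f u + f v.
Proof. exact: dual_linear. Qed.

Lemma normc_dual f u : normc (f u) <= dual_norm f * ell1_norm u.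
Proof. by rewrite -lecR rmorphM/=; exact: ler_dual_norm. Qed.

Lemma dual_ext f g : (forall x, f (delta x) = g (delta x)) -> f = g.
Proof.
move=> fg; apply/eqP; rewrite -subr_eq0; apply/eqP/val_inj/funext.
apply: (ell1_dense (M := dual_norm (f - g)) _ (normc_dual (f - g))).
  exact: dualPE.
move=> x; transitivity (f (delta x) - g (delta x) : R[i]); first by [].
by apply/eqP; rewrite subr_eq0 fg.
Qed.

Lemma bilinear_dense (B : ell1 w -> ell1 w -> R[i]) (M : R) :
  (forall c u u' v, B (c *: u + u') v = c * B u v + B u' v) ->
  (forall u c v v', B u (c *: v + v') = c * B u v + B u v') ->
  (forall u v, normc (B u v) <= M * ell1_norm u * ell1_norm v) ->
  (forall x y, B (delta x) (delta y) = 0) -> forall u v, B u v = 0.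
Proof.
move=> Bl Br BM B0 u v; move: u.
apply: (ell1_dense (M := M * ell1_norm v)) => [c u u'|u|x].
- exact: Bl.
- by rewrite mulrAC.
- move: v; apply: (ell1_dense (M := M * w x)) => [c v v'|v|//].
    exact: Br.
  by rewrite -ell1_norm_delta.
Qed.

Lemma ler_ell1_norm_mul (u v : ell1 w) :
  ell1_norm (bmul u v) <= ell1_norm u * ell1_norm v.
Proof. by have := ler_ell1_mul u v; rewrite !ell1_normE -rmorphM/= lecR. Qed.

End duals.

(** * Derivations built from coboundaries *)

Section coboundary.
Context {R : realType} {G : groupType} {w : weight R G}.
Implicit Types a b u : ell1 w.

(** The kernel is extended one variable at a time: [K z] extends it in [x] for fixed [z], then [D a]
    extends [K z a] in [z]. *)
Lemma kernel_operator (k : G -> G -> R[i]) (M : R) :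
  (forall z x, normc (k z x) <= M * (w z * w x)) ->
  exists D : ell1 w -> dual (ell1 w), [/\ linear D,
    forall a u, normc (D a u) <= M * ell1_norm a * ell1_norm u &
    forall x z, D (delta x) (delta z) = k z x].
Proof.
move=> kM; have kz z x : normc (k z x) <= M * w z * w x by rewrite -mulrA.
have [K Kk] := choice (fun z => functional_exists (kz z)).
have hM a z : normc (K z a) <= M * ell1_norm a * w z.
  by rewrite mulrAC; exact: (Kk z).2.
have [D DK] := choice (fun a => functional_exists (hM a)).
exists D; split=> [c a b|a u|x z].
- apply: dual_ext => z; rewrite dualDE dualZE.
  by rewrite (DK (_ + _)).1 (DK a).1 (DK b).1; exact: dual_linear.
- exact: (DK a).2.
- by rewrite (DK _).1 (Kk z).1.
Qed.

Lemma kernel_operator_cts (D : ell1 w -> dual (ell1 w)) (M : R) : linear D ->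
  (forall a u, normc (D a u) <= M * ell1_norm a * ell1_norm u) -> continuous D.
Proof.
move=> lin DM; apply: (bounded_linear_cts (M := M) lin) => a.
rewrite ell1_normE -rmorphM/= -[leLHS]/((dual_norm (D a))%:C) lecR.
apply: dual_norm_le => u; rewrite ell1_normE lecR => u1.
rewrite -[leLHS]/((normc (D a u))%:C) lecR.
apply: le_trans (DM a u) _; rewrite -[leRHS]mulr1 ler_wpM2l//.
have := le_trans (normc_ge0 _) (DM a (delta 1%g)).
by rewrite ell1_norm_delta pmulr_lge0// weight_gt0.
Qed.

(** On point masses the Leibniz rule telescopes: both sides equal F(zxy) - F(xyz), the term F(yzx)
    cancelling. Density gives the rest. *)
Lemma coboundary_derivation (F : G -> R[i]) (M : R) :
  (forall z x, normc (F (z * x)%g - F (x * z)%g) <= M * (w z * w x)) ->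
  exists D : ell1 w -> dual (ell1 w), [/\ derivation D, continuous D &
    forall x z, D (delta x) (delta z) = F (z * x)%g - F (x * z)%g].
Proof.
move=> FM; have [D [lin DM DF]] := kernel_operator FM.
exists D; split=> //; last exact: kernel_operator_cts lin DM.
split=> // a b; apply: dual_ext => z; apply/eqP; rewrite dualDE -subr_eq0.
apply/eqP; move: a b.
have M0 : 0 <= M.
  have := le_trans (normc_ge0 _) (FM 1%g 1%g).
  by rewrite pmulr_lge0// mulr_gt0// weight_gt0.
(* One multiple of [M * w z] for each of the three terms of the Leibniz rule. *)
apply: (bilinear_dense (M := M * w z *+ 3)) => [c u u' v|u c v v'|u v|x y].
- rewrite /= bmulDl -bscalerAl bmulDr -bscalerAr !lin !dualDE !dualZE dualPE.
  ring.
- rewrite /= bmulDl -bscalerAl bmulDr -bscalerAr !lin !dualDE !dualZE dualPE.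
  ring.
- have Dle p q n : ell1_norm p * ell1_norm q <= n -> normc (D p q) <= M * n.
    by move=> pqn; rewrite (le_trans (DM p q))// -mulrA ler_wpM2l.
  rewrite [leRHS](_ : _ = M * (ell1_norm u * ell1_norm v * w z) +
    (M * (ell1_norm v * (w z * ell1_norm u)) +
     M * (ell1_norm u * (ell1_norm v * w z)))); last by ring.
  rewrite (le_trans (normcD _ _))// lerD//; last first.
    rewrite normcN (le_trans (normcD _ _))// lerD//.
      rewrite Dle// ler_wpM2l ?ell1_norm_ge0//.
      by rewrite (le_trans (ler_ell1_norm_mul _ _))// ell1_norm_delta.
    rewrite Dle// ler_wpM2l ?ell1_norm_ge0//.
    by rewrite (le_trans (ler_ell1_norm_mul _ _))// ell1_norm_delta.
  rewrite Dle// ell1_norm_delta ler_wpM2r ?ler_ell1_norm_mul//.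
  by rewrite ltW// weight_gt0.
- rewrite /= !delta_mul !DF !mulgA; ring.
Qed.

(** Reduces weak amenability to a test on functions on [G], which the necessity proof applies to one
    explicit [F]. *)
Lemma weakly_amenable_coboundary (F : G -> R[i]) (M : R) :
  weakly_amenable (ell1 w) ->
  (forall z x, normc (F (z * x)%g - F (x * z)%g) <= M * (w z * w x)) ->
  exists (f : G -> R[i]) (L : R), (forall x, normc (f x) <= L * w x) /\
  forall x z, F (z * x)%g - F (x * z)%g = f (z * x)%g - f (x * z)%g.
Proof.
move=> wa /coboundary_derivation[D [Dder Dcts DF]].
have [f Df] := wa D Dder Dcts.
exists (fun x => f (delta x)), (dual_norm f); split=> [x|x z].
  by rewrite (le_trans (normc_dual _ _))// ell1_norm_delta.
by rewrite -DF Df dualDE dualNE /= !delta_mul.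
Qed.

End coboundary.

(** * Weak amenability for bounded weights *)

Section bounded_weight.
Context {R : realType} {G : groupType}.

(* With c x z = <delta_z, D delta_x>, the hypothesis on products is the Leibniz
   rule; passing to y |-> c x (x^-1 y) turns it into an additive cocycle for
   conjugation, which is trivialised by a pointwise supremum over x. *)
Lemma bounded_cocycle_inner (c : G -> G -> R) (B : R) :
  (forall x z, `|c x z| <= B) ->
  (forall x y z, c (x * y)%g z = c y (z * x)%g + c x (y * z)%g) ->
  exists s : G -> R, (forall y, `|s y| <= B) /\
    forall x z, c x z = s (x * z)%g - s (z * x)%g.
Proof.
move=> cB cM; pose X y := [set c u (u^-1 * y)%g | u in [set: G]].
have X0 y : X y !=set0 by exists (c 1 (1^-1 * y))%g, 1%g.
have le_sX u y : c u (u^-1 * y)%g <= sup (X y).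
  apply: ub_le_sup; last by exists u.
  by exists B => _ [v _ <-]; exact: le_trans (ler_norm _) (cB _ _).
have sX_le y b : (forall u, c u (u^-1 * y)%g <= b) -> sup (X y) <= b.
  by move=> cb; apply: ge_sup => // _ [u _ <-].
exists (fun y => sup (X y)); split=> [y|x z].
  rewrite ler_norml (le_trans _ (le_sX 1%g y))/=; last first.
    by have := cB 1%g (1^-1 * y)%g; rewrite ler_norml => /andP[].
  by apply: sX_le => u; exact: le_trans (ler_norm _) (cB _ _).
(* The substitution u = xy turns the term at u of the family for xz into the term at y of the family
   for zx, plus [c x z]. Both inequalities compare suprema through this bijection. *)
apply/eqP; rewrite eq_le lerBrDr lerBlDl; apply/andP; split.
  rewrite -lerBrDl; apply: sX_le => y; rewrite lerBrDr.
  apply: le_trans (le_sX (x * y)%g (x * z)%g).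
  by rewrite invgM cM !mulgA mulgV mul1g -(mulgA _ x^-1)%g mulVg mulg1 mul1g.
apply: sX_le => u; have -> : u = (x * (x^-1 * u))%g by rewrite mulgA mulgV mul1g.
set y := (x^-1 * u)%g.
have -> : ((x * y)^-1 * (x * z) = y^-1 * z)%g.
  by rewrite invgM -!mulgA (mulgA _ x) mulVg mul1g.
rewrite cM mulgA mulgV mul1g lerD2r -mulgA; exact: le_sX.
Qed.

Context {w : weight R G}.

Lemma bounded_weakly_amenable (C : R) : (forall x, w x <= C) ->
  weakly_amenable (ell1 w).
Proof.
move=> wC D [lin Dder] Dcts.
have [M DM] := cts_linear_bounded lin Dcts.
have w0 x : 0 < w x := weight_gt0 w x.
have C0 : 0 < C := lt_le_trans (w0 1%g) (wC 1%g).
have DMM a u : normc (D a u) <= M * ell1_norm a * ell1_norm u.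
  apply: le_trans (normc_dual _ _) _; rewrite ler_wpM2r ?ell1_norm_ge0//.
  have := DM a; rewrite ell1_normE -rmorphM/=.
  by rewrite -[leLHS]/((dual_norm (D a))%:C) lecR.
have M0 : 0 <= M.
  have := le_trans (normc_ge0 _) (DMM (delta 1%g) (delta 1%g)).
  by rewrite !ell1_norm_delta -mulrA pmulr_lge0// mulr_gt0.
pose c x z : R[i] := D (delta x) (delta z).
have cB x z : normc (c x z) <= M * C * C.
  apply: le_trans (DMM _ _) _; rewrite !ell1_norm_delta -!mulrA ler_wpM2l//.
  by rewrite ler_pM// ltW.
have cM x y z : c (x * y)%g z = c y (z * x)%g + c x (y * z)%g.
  by rewrite /c -!delta_mul Dder.
(* Suprema need real values, so the real and imaginary parts are trivialised separately. *)
have [sr [srB cr]] : exists s : G -> R, (forall y, `|s y| <= M * C * C) /\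
    forall x z, Re (c x z) = s (x * z)%g - s (z * x)%g.
  apply: bounded_cocycle_inner => [x z|x y z]; last by rewrite cM raddfD.
  exact: le_trans (normc_Re _) (cB x z).
have [si [siB ci]] : exists s : G -> R, (forall y, `|s y| <= M * C * C) /\
    forall x z, Im (c x z) = s (x * z)%g - s (z * x)%g.
  apply: bounded_cocycle_inner => [x z|x y z]; last by rewrite cM raddfD.
  exact: le_trans (normc_Im _) (cB x z).
(* The sign matches the order in [lact a f - ract f a], which is F(zx) - F(xz) on point masses. *)
pose s y : R[i] := - (sr y +i* si y).
have cE x z : c x z = s (z * x)%g - s (x * z)%g.
  apply/eqP; rewrite eq_complex !raddfB !raddfN /= cr ci.
  by apply/andP; split; apply/eqP; lra.
have sB y : normc (s y) <= (M * C * C *+ 2 * C) * w y.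
  apply: (@le_trans _ _ (M * C * C *+ 2)).
    rewrite /s normcN (_ : sr y +i* si y = (sr y)%:C + 0 +i* si y); last first.
      by apply/eqP; rewrite eq_complex /= addr0 add0r !eqxx.
    rewrite (le_trans (normcD _ _))// mulr2n /= !expr0n /= addr0 add0r.
    by rewrite !sqrtr_sqr lerD.
  rewrite -[leRHS]mulrA ler_peMr //.
    by rewrite mulrn_wge0// !mulr_ge0// ltW.
  (* An upper bound on [w] forces a lower one: 1 <= w(1) <= w(y^-1) w(y) <= C w(y). So the bounded
     [s] is dominated by [w]. *)
  have w1 : 1 <= w 1%g.
    by have := weightM w 1%g 1%g; rewrite mulg1 ler_pMr.
  apply: le_trans w1 _; rewrite -(mulVg y).
  by apply: le_trans (weightM _ _ _) _; rewrite ler_wpM2r// ltW.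
have [f [fs fB]] := functional_exists sB.
exists f => a; apply: dual_ext => z; rewrite dualDE dualNE.
apply/eqP; rewrite -subr_eq0; apply/eqP; move: a.
apply: (ell1_dense (M := M * w z + dual_norm f * w z *+ 2)) => [k a b|a|x].
- rewrite lin dualDE dualZE /= bmulDl bmulDr -bscalerAl -bscalerAr !dualPE.
  ring.
- rewrite [leRHS](_ : _ = M * ell1_norm a * w z +
    (dual_norm f * (w z * ell1_norm a) + dual_norm f * (ell1_norm a * w z)));
    last by ring.
  rewrite (le_trans (normcD _ _))// lerD//.
    by have := DMM a (delta z); rewrite ell1_norm_delta.
  rewrite normcN (le_trans (normcD _ _))// lerD// ?normcN.
    rewrite (le_trans (normc_dual f _))// ler_wpM2l ?dual_norm_ge0//.
    by rewrite (le_trans (ler_ell1_norm_mul _ _))// ell1_norm_delta.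
  rewrite (le_trans (normc_dual f _))// ler_wpM2l ?dual_norm_ge0//.
  by rewrite (le_trans (ler_ell1_norm_mul _ _))// ell1_norm_delta.
- by rewrite /= !delta_mul !fs -cE subrr.
Qed.

End bounded_weight.

(** * The affine group *)

Section affine_group.
Context {R : realType}.
Implicit Types (x y : axb R) (s t : R).

Lemma axb_eq x y : x.1 = y.1 -> x.2 = y.2 -> x = y.
Proof.
move=> e1 e2; apply/val_inj; rewrite /= (surjective_pairing (axb_val x)).
by rewrite (surjective_pairing (axb_val y)) e1 e2.
Qed.

Lemma axb_mul1E x y : (x * y)%g.1 = x.1 * y.1.
Proof. by []. Qed.

Lemma axb_mul2E x y : (x * y)%g.2 = x.1 * y.2 + x.2.
Proof. by []. Qed.

Definition dilation t : axb R := @Axb R (expR t, 0) (expR_gt0 t).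
Definition translation t : axb R := @Axb R (1, t) ltr01.

Lemma dilationD s t : dilation (s + t) = (dilation s * dilation t)%g.
Proof. by apply: axb_eq => /=; [exact: expRD|ring]. Qed.

(** Once [w] is bounded on translations, this factorisation and [axb_decomp] compare [w] at [x] and
    at its dilation part, in both directions. *)
Lemma dilation_ln x : dilation (ln x.1) = (translation (- x.2) * x)%g.
Proof.
apply: axb_eq; rewrite ?axb_mul1E ?axb_mul2E /=; last by ring.
by rewrite lnK ?mul1r// posrE axb_gt0.
Qed.

Lemma axb_decomp x : x = (translation x.2 * dilation (ln x.1))%g.
Proof.
apply: axb_eq; rewrite ?axb_mul1E ?axb_mul2E /=; last by ring.
by rewrite lnK ?mul1r// posrE axb_gt0.
Qed.

End affine_group.

Lemma normc_realB {R : realType} (a b : R) : normc (a%:C - b%:C) = `|a - b|.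
Proof. by rewrite -rmorphB /= expr0n addr0 sqrtr_sqr. Qed.

(** * Weak amenability bounds the weight on dilations *)

Section unbounded_dilations.
Context {R : realType} {w : weight R (axb R)}.
Implicit Types (x y z : axb R) (s t : R).
Variable B : R.
Hypothesis wB : forall t, w (translation t) <= B.

Let w0 x : 0 < w x := weight_gt0 w x.

Let B0 : 0 < B := lt_le_trans (w0 (translation 0)) (wB 0).

Definition dil_weight t := w (dilation t) * w (dilation (- t)).

Lemma dil_weight_gt0 t : 0 < dil_weight t.
Proof. by rewrite mulr_gt0. Qed.

Lemma dil_weightN t : dil_weight (- t) = dil_weight t.
Proof. by rewrite /dil_weight opprK mulrC. Qed.

Lemma ln_dil_weightD s t :
  ln (dil_weight (s + t)) <= ln (dil_weight s) + ln (dil_weight t).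
Proof.
rewrite -lnM ?posrE ?dil_weight_gt0// ler_ln ?posrE ?mulr_gt0 ?dil_weight_gt0//.
by rewrite /dil_weight opprD !dilationD mulrACA ler_pM ?weightM// ltW.
Qed.

(** Evenness and subadditivity bound the increment by ln V(t). Weakening this to V(t) gives a
    product of two weights, the form a kernel bound requires. *)
Lemma ln_dil_weight_lip s t :
  `|ln (dil_weight (t + s)) - ln (dil_weight s)| <= dil_weight t.
Proof.
apply: (@le_trans _ _ (ln (dil_weight t))); last first.
  by apply/ltW/ln_sublinear/dil_weight_gt0.
have := ln_dil_weightD t s; have := ln_dil_weightD (- t) (t + s).
rewrite addKr dil_weightN ler_norml => ? ?; apply/andP; split; lra.
Qed.

Lemma weight_dilation_le x : w (dilation (ln x.1)) <= B * w x.
Proof.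
by rewrite dilation_ln (le_trans (weightM _ _ _))// ler_wpM2r ?wB// ltW.
Qed.

Lemma weight_le_dilation x : w x <= B * w (dilation (ln x.1)).
Proof.
by rewrite {1}(axb_decomp x) (le_trans (weightM _ _ _))// ler_wpM2r ?wB// ltW.
Qed.

(* A function on the conjugacy class {(1, b) : b > 0}, where w is bounded;
   conjugating by (a, 0) multiplies b by a, i.e. translates ln b. *)
Let F z : R[i] :=
  if (z.1 == 1) && (0 < z.2) then (ln (dil_weight (ln z.2)))%:C else 0.

Let F_bound z x : normc (F (z * x)%g - F (x * z)%g) <= B ^+ 2 * (w z * w x).
Proof.
have rhs0 : 0 <= B ^+ 2 * (w z * w x).
  by rewrite mulr_ge0// ?exprn_ge0// ltW// mulr_gt0.
rewrite /F !axb_mul1E !axb_mul2E (mulrC x.1 z.1).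
have [zx1|_] := eqVneq (z.1 * x.1) 1; last by rewrite subrr normc0.
(* When zx is a translation, its second coordinate is [z.1] times that of xz: the signs agree and
   the logarithms differ by [ln z.1]. *)
have -> : z.1 * x.2 + z.2 = z.1 * (x.1 * z.2 + x.2).
  by rewrite mulrDr mulrA zx1 mul1r addrC.
rewrite pmulr_rgt0 ?axb_gt0//; have [d0|_] := ltP; last by rewrite subrr normc0.
rewrite normc_realB lnM ?posrE ?axb_gt0//.
apply: le_trans (ln_dil_weight_lip _ _) _.
have -> : B ^+ 2 * (w z * w x) = (B * w z) * (B * w x) by ring.
rewrite ler_pM ?weight_dilation_le ?(ltW (w0 _))//.
(* The two factors of V at [ln z.1] are the weights of the dilation parts of [z] and of [x]. *)
have -> : - ln z.1 = ln x.1.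
  by apply/eqP; rewrite eq_sym -addr_eq0 addrC -lnM ?posrE ?axb_gt0// zx1 ln1.
exact: weight_dilation_le.
Qed.

Lemma weakly_amenable_dil_weight : weakly_amenable (ell1 w) ->
  exists C, forall t, dil_weight t <= C.
Proof.
move=> /weakly_amenable_coboundary/(_ F_bound)[f [L [fL Ff]]].
have fB t : normc (f (translation t)) <= `|L| * B.
  apply: le_trans (fL _) _; apply: le_trans (ler_wpM2r (ltW (w0 _)) (ler_norm L)) _.
  by rewrite ler_wpM2l.
(* ln V(0) is the value of [F] at [translation 1]; each of the two values of [f] contributes at most
   [|L| * B]. *)
exists (expR (ln (dil_weight 0) + `|L| * B *+ 2)) => t.
rewrite -ler_ln ?posrE ?dil_weight_gt0 ?expR_gt0// expRK -lerBlDl.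
(* The two orders of multiplication give [translation 1] and its conjugate
   [translation (expR (- t))], where [F] is ln V(0) and ln V(-t) = ln V(t). *)
have := Ff (dilation t) (dilation (- t) * translation 1)%g.
have -> : (dilation t * (dilation (- t) * translation 1) = translation 1)%g.
  apply: axb_eq; rewrite !(axb_mul1E, axb_mul2E) /= expRN;
    by field; rewrite gt_eqF// expR_gt0.
have -> : (dilation (- t) * translation 1 * dilation t =
           translation (expR (- t)))%g.
  apply: axb_eq; rewrite !(axb_mul1E, axb_mul2E) /= expRN;
    by field; rewrite gt_eqF// expR_gt0.
rewrite /F /= eqxx ltr01 expR_gt0 expRK ln1 dil_weightN /= => Fe.
rewrite (le_trans (ler_norm _))//.
rewrite -normc_realB Fe.
by rewrite mulr2n (le_trans (normcD _ _))// lerD// normcN.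
Qed.

End unbounded_dilations.

(** * The equivalence on the affine group *)

Theorem proposition3p2 (R : realType) (w : weight R (axb R)) :
  (exists2 c : R, 0 < c & forall x : axb R, c <= w x) ->
  has_ubound [set w x | x in @Hb R] ->
  (weakly_amenable (ell1 w) <-> diagonally_bounded w).
Proof.
move=> [c c0 wc] [B0 wB0]; have w0 x : 0 < w x := weight_gt0 w x.
have wB t : w (translation t) <= B0 by apply: wB0; exists (translation t).
split=> [wa|[K wK]]; last first.
  (* The lower bound c <= w(x^-1) turns w(x) w(x^-1) <= K into w(x) <= K / c. *)
  apply: (bounded_weakly_amenable (C := K / c)) => x.
  rewrite ler_pdivlMr// (@le_trans _ _ (w x * w x^-1%g))//.
    by rewrite ler_pM2l.
  by apply: wK; exists x.
have [C dC] := weakly_amenable_dil_weight wB wa.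
exists (B0 ^+ 2 * C) => _ [x _ <-].
(* Passing to dilation parts costs a factor [B0] for each of [x] and its inverse. *)
apply: (@le_trans _ _ (B0 ^+ 2 * dil_weight (w := w) (ln x.1))); last first.
  by rewrite ler_wpM2l// exprn_ge0// ltW// (lt_le_trans (w0 _) (wB 0)).
rewrite /dil_weight -lnV ?posrE ?axb_gt0//.
have -> : B0 ^+ 2 * (w (dilation (ln x.1)) * w (dilation (ln x.1^-1))) =
  (B0 * w (dilation (ln x.1))) * (B0 * w (dilation (ln x.1^-1))) by ring.
rewrite ler_pM ?(weight_le_dilation wB) ?(ltW (w0 _))//.
Qed.
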